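(* Let $a=(a_i)_{i\in\mathbb Z}$ be a sequence in $\Bbbk$. For any $n\ge1$, in $\mathrm{Sym}^a$, $$\Lambda_{n;a}=(-1)^{n-1}|A|_{1n},\qquad S_{n;a}=(-1)^{n-1}|B|_{1n},$$ where $A$ and $B$ are the $n\times n$ matrices with entries $$A_{pq}=\begin{cases}S_{q-p+1;a}^{[n-p]}&p\le q,\\ 1&p=q+1,\\ 0&p>q+1,\end{cases}\qquad B_{pq}=\begin{cases}\Lambda_{q-p+1;a}^{[1-q]}&p\le q,\\ 1&p=q+1,\\ 0&p>q+1.\end{cases}$$
   Context: $\Bbbk$ is a field of characteristic zero and $a=(a_i)_{i\in\mathbb Z}$ is a sequence in $\Bbbk$. Put $(t\downarrow a)^k=(t-a_1)\cdots(t-a_k)$, $(t\downarrow a)^0=1$, $(\tau^s a)_i=a_{i+s}$ for $s\in\mathbb Z$, and $\hat a_i=-a_{-i+1}$. $\mathrm{Sym}^a=\Bbbk\langle S_{1;a},S_{2;a},\ldots\rangle$ is the free associative unital $\Bbbk$-algebra on $S_{k;a}$, $k\ge1$. With $t$ a central variable and all expressions expanded as formal power series in $1/t$, put $\sigma^a(t)=\sum_{k\ge0}S_{k;a}/(t\downarrow a)^k$ and $\lambda^{\hat a}(t)=\sum_{k\ge0}\Lambda_{k;a}/(t\downarrow\hat a)^k$ with $S_{0;a}=\Lambda_{0;a}=1$; the elements $\Lambda_{k;a}\in\mathrm{Sym}^a$ are determined by $\lambda^{\hat a}(-t)\sigma^a(t)=\sigma^a(t)\lambda^{\hat a}(-t)=1$.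 Shifts: for $s\in\mathbb Z$, $S_{k;a}^{[s]}$ and $\Lambda_{k;a}^{[s]}$ are defined by $\sum_{k\ge0} S_{k;a}^{[s]}/(t\downarrow\tau^{-s}a)^k=\sum_{k\ge0}S_{k;a}/(t\downarrow a)^k$ and $\sum_{k\ge0}\Lambda_{k;a}^{[s]}/(t\downarrow\tau^{s}\hat a)^k=\sum_{k\ge0}\Lambda_{k;a}/(t\downarrow\hat a)^k$. Quasideterminants: for an $n\times n$ matrix $A$ over a unital ring such that the matrix $A^{pq}$ (delete row $p$ and column $q$) is invertible, $|A|_{pq}=a_{pq}-r(A^{pq})^{-1}c$, where $r$ is the $p$-th row of $A$ with $a_{pq}$ removed and $c$ is the $q$-th column of $A$ with $a_{pq}$ removed. (For the matrices here and $(p,q)=(1,n)$, the matrix $A^{1n}$ is upper unitriangular.) *)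

(* Defs.v *)
From Stdlib Require Import ClassicalEpsilon.
From HB Require Import structures.
From mathcomp Require Import all_boot all_order all_algebra.
From mathcomp Require Import monalg.

Set Implicit Arguments.
Unset Strict Implicit.
Unset Printing Implicit Defensive.

Import GRing.Theory.

Local Open Scope ring_scope.

(* A formal power series in 1/t (with t central) is represented by its
   coefficient function: f m is the coefficient of t^-m. *)
Section Series.
Variable R : nzRingType.
Implicit Types f g h : nat -> R.

Definition ser1 : nat -> R := fun m => (m == 0%N)%:R.

Definition serM f g : nat -> R :=
  fun m => \sum_(i < m.+1) f i * g (m - i)%N.

(* The substitution t := - t. *)
Definition serN f : nat -> R := fun m => (-1) ^+ m * f m.

(* 1/(t - x) = \sum_(j >= 0) x^j t^-(j+1). *)
Definition ser_invlin (x : R) : nat -> R :=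
  fun m => if m is j.+1 then x ^+ j else 0.

(* 1/((t - b_1) ... (t - b_k)). *)
Fixpoint ser_invfall (b : int -> R) (k : nat) : nat -> R :=
  if k is j.+1 then serM (ser_invfall b j) (ser_invlin (b j.+1%:Z)) else ser1.

End Series.

Arguments ser1 {R}.

Definition tau (K : Type) (s : int) (a : int -> K) : int -> K :=
  fun i => a (i + s).

Definition hat (K : zmodType) (a : int -> K) : int -> K :=
  fun i => - a (- i + 1).

(* \sum_(k >= 0) c_k / (t \downarrow b)^k.  The coefficient of t^-m is a finite
   sum because 1/(t \downarrow b)^k has no term t^-m with m < k; see
   [ser_invfall_lt]. *)
Definition fall_ser (K : comNzRingType) (R : lalgType K)
    (b : int -> K) (c : nat -> R) : nat -> R :=
  fun m => \sum_(k < m.+1) ser_invfall b k m *: c k.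

(* The generator S_{k;a}, k >= 1, is the free variable of index k - 1. *)
Definition Sym (K : fieldType) := {malg K[{fmonom nat}]}.

Definition S_ (K : fieldType) (k : nat) : Sym K :=
  if k is j.+1 then << fmu j >> else 1.

Definition is_Lambda (K : fieldType) (a : int -> K) (L : nat -> Sym K) : Prop :=
  [/\ L 0%N = 1,
      serM (serN (fall_ser (hat a) L)) (fall_ser a (S_ K)) =1 ser1
    & serM (fall_ser a (S_ K)) (serN (fall_ser (hat a) L)) =1 ser1].

(* Existence and uniqueness: [LambdaP] and [Lambda_unique]. *)
Definition Lambda (K : fieldType) (a : int -> K) : nat -> Sym K :=
  epsilon (inhabits (fun=> 0)) (is_Lambda a).

(* Coefficients of f in the expansion along the 1/(t \downarrow b)^k; existence
   and uniqueness: [fall_coefP] and [fall_ser_inj]. *)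
Definition fall_coef (K : comNzRingType) (R : lalgType K) (b : int -> K)
    (f : nat -> R) : nat -> R :=
  epsilon (inhabits (fun=> 0)) (fun c => fall_ser b c =1 f).

Definition S_shift (K : fieldType) (a : int -> K) (s : int) : nat -> Sym K :=
  fall_coef (tau (- s) a) (fall_ser a (S_ K)).

Definition Lambda_shift (K : fieldType) (a : int -> K) (s : int) :
    nat -> Sym K :=
  fall_coef (tau s (hat a)) (fall_ser (hat a) (Lambda a)).

Section Quasideterminant.
Variable R : nzRingType.

Definition is_mxinv n (A B : 'M[R]_n) : Prop :=
  A *m B = 1%:M /\ B *m A = 1%:M.

(* Arbitrary when A has no two-sided inverse. *)
Definition mxinv n (A : 'M[R]_n) : 'M[R]_n :=
  epsilon (inhabits 0) (is_mxinv A).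

(* Meaningful only when row' p (col' q A) is invertible; for the matrices [hess]
   below and (p, q) = (ord0, ord_max), see [hess_minor_inv]. *)
Definition quasidet n (A : 'M[R]_n) (p q : 'I_n) : R :=
  A p q - (row p (col' q A) *m mxinv (row' p (col' q A))
             *m col q (row' p A)) 0 0.

(* F is given with indices p, q starting from 1. *)
Definition hess n (F : nat -> nat -> R) : 'M[R]_n :=
  \matrix_(i < n, j < n)
    let p := i.+1 in let q := j.+1 in
    if (p <= q)%N then F p q else if p == q.+1 then 1 else 0.

Lemma mxinv_unique n (A B C : 'M[R]_n) : is_mxinv A B -> is_mxinv A C -> B = C.
Proof.
by move=> [_ lB] [rC _]; rewrite -[B]mulmx1 -rC mulmxA lB mul1mx.
Qed.

Lemma mxinvP n (A B : 'M[R]_n) : is_mxinv A B -> is_mxinv A (mxinv A).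
Proof. by move=> AB; apply: epsilon_spec; exists B. Qed.

Lemma unitriangular_inv n (U : 'M[R]_n) :
  (forall i, U i i = 1) -> (forall i j : 'I_n, (j < i)%N -> U i j = 0) ->
  exists V, is_mxinv U V.
Proof.
elim: n U => [|n IHn] U U1 U0.
  by exists 0; split; apply/matrixP=> - [].
rewrite -[n.+1]/(1 + n)%N in U U1 U0 *.
have [|i j ltji|V [UV VU]] := IHn (drsubmx U); first by move=> i; rewrite !mxE.
  by rewrite !mxE U0 //= ltnS.
have -> : U = block_mx 1 (ursubmx U) 0 (drsubmx U).
  rewrite -{1}[U]submxK; congr block_mx.
    by apply/matrixP=> i j; rewrite !ord1 !mxE -[lshift n 0]/(lshift n 0) U1.
  by apply/matrixP=> i j; rewrite !ord1 !mxE U0.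
exists (block_mx 1 (- (ursubmx U *m V)) 0 V); split; rewrite mulmx_block.
  rewrite !mulmx0 !mul0mx !mulmx1 !mul1mx UV !addr0 !add0r addNr.
  by rewrite -scalar_mx_block.
rewrite !mulmx0 !mul0mx !mulmx1 !mul1mx VU !addr0 !add0r mulNmx -mulmxA VU.
by rewrite mulmx1 subrr -scalar_mx_block.
Qed.

Lemma hess_minor_inv n (F : nat -> nat -> R) :
  let M := row' ord0 (col' ord_max (hess n.+1 F)) in is_mxinv M (mxinv M).
Proof.
move=> M.
have [i|i j ltji|V MV] := @unitriangular_inv _ M; last exact: mxinvP MV.
  by rewrite !mxE lift0 lift_max /= ltnn eqxx.
rewrite !mxE lift0 lift_max /= ltnNge (leqW ltji) /=.
by rewrite eqSS gtn_eqF.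
Qed.

End Quasideterminant.

(* Solving triangular recurrences. *)
Lemma course_of_values (T : Type) (x0 : T) (step : nat -> (nat -> T) -> T) :
  (forall n f g, (forall i, (i < n)%N -> f i = g i) -> step n f = step n g) ->
  exists f, forall n, f n = step n f.
Proof.
move=> step_ext.
pose fix tab n : nat -> T := if n is m.+1
  then fun i => if (i < m)%N then tab m i else step m (tab m) else fun=> x0.
have tabE i n : (i < n)%N -> tab n i = tab i.+1 i.
  elim: n => // n IHn; rewrite ltnS leq_eqVlt => /orP[/eqP -> //|lt_in].
  by rewrite [LHS]/= lt_in IHn.
exists (fun n => tab n.+1 n) => n; rewrite /= ltnn; apply: step_ext => i.
exact: tabE.
Qed.

Section SeriesTheory.
Variable R : nzRingType.
Implicit Types f g h : nat -> R.

Lemma serME f g N m : (m < N)%N ->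
  serM f g m = ((\poly_(i < N) f i) * (\poly_(i < N) g i))`_m.
Proof.
move=> ltmN; rewrite coefM; apply: eq_bigr => -[i /= ltim] _.
rewrite !coef_poly (leq_ltn_trans _ ltmN) //.
by rewrite (leq_ltn_trans (leq_subr _ _) ltmN).
Qed.

Lemma serMA f g h : serM (serM f g) h =1 serM f (serM g h).
Proof.
move=> m; pose P f := \poly_(i < m.+1) f i.
transitivity ((P f * P g * P h)`_m).
  rewrite coefM; apply: eq_bigr => -[i /= ltim] _.
  by rewrite -serME // coef_poly ltnS leq_subr.
rewrite -mulrA coefM; apply: eq_bigr => -[i /= ltim] _.
by rewrite -serME ?ltnS ?leq_subr // coef_poly ltim.
Qed.

Lemma ser1M f : serM ser1 f =1 f.
Proof.
move=> m; rewrite /serM big_ord_recl subn0 mul1r big1 ?addr0 // => i _.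
by rewrite mul0r.
Qed.

Lemma serM1 f : serM f ser1 =1 f.
Proof.
move=> m; rewrite /serM big_ord_recr /= subnn mulr1 big1 ?add0r // => i _.
by rewrite /ser1 subn_eq0 leqNgt ltn_ord mulr0.
Qed.

Lemma eq_serM f f' g g' : f =1 f' -> g =1 g' -> serM f g =1 serM f' g'.
Proof. by move=> ff' gg' m; apply: eq_bigr => i _; rewrite ff' gg'. Qed.

Lemma serNK f : serN (serN f) =1 f.
Proof. by move=> m; rewrite /serN mulrA -expr2 sqrr_sign mul1r. Qed.

Lemma ser_invU f l r : serM l f =1 ser1 -> serM f r =1 ser1 -> l =1 r.
Proof.
move=> lf fr m; rewrite -[RHS]ser1M -[LHS]serM1.
by rewrite -(eq_serM lf (frefl r)) serMA (eq_serM (frefl l) fr).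
Qed.

Lemma ser_inv f : f 0%N = 1 ->
  exists g, serM f g =1 ser1 /\ serM g f =1 ser1.
Proof.
move=> f0.
have [|r rE] := @course_of_values R 0 (fun n r =>
    ser1 n - \sum_(i < n) f i.+1 * r (n - i.+1)%N).
  move=> n r r' rr'; congr (_ - _); apply: eq_bigr => i _.
  by rewrite rr' // ltn_subrL /= (leq_ltn_trans _ (ltn_ord i)).
have [|l lE] := @course_of_values R 0 (fun n l =>
    ser1 n - \sum_(i < n) l i * f (n - i)%N).
  by move=> n l l' ll'; congr (_ - _); apply: eq_bigr => i _; rewrite ll'.
have fr : serM f r =1 ser1.
  by move=> m; rewrite /serM big_ord_recl f0 mul1r subn0 [X in X + _]rE subrK.
have lf : serM l f =1 ser1.
  by move=> m; rewrite /serM big_ord_recr /= subnn f0 mulr1 [X in _ + X]lE addrC subrK.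
exists r; split=> // m; rewrite -[RHS]lf; apply: eq_serM => // i.
by rewrite (ser_invU lf fr).
Qed.

(* In (t - x) f the coefficient of t^-m is f (m.+1) - x * f m, and that of t is
   f 0. *)
Lemma ser_invlinP (x : R) :
  ser_invlin x 0 = 0 /\
  forall m, ser_invlin x m.+1 - x * ser_invlin x m = ser1 m.
Proof.
split=> // -[|m] /=; first by rewrite mulr0 subr0.
by rewrite exprS subrr.
Qed.

Lemma ser_invfall_lt (b : int -> R) k m :
  (m < k)%N -> ser_invfall b k m = 0.
Proof.
elim: k m => // k IHk m lt_mk; rewrite /= /serM big1 // => -[i /= le_im] _.
have [lt_ik|le_ki] := ltnP i k; first by rewrite IHk ?mul0r.
suff -> : (m - i = 0)%N by rewrite mulr0.
by apply/eqP; rewrite subn_eq0 (leq_trans _ le_ki).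
Qed.

Lemma ser_invfall_diag (b : int -> R) k : ser_invfall b k k = 1.
Proof.
elim: k => // k IHk; rewrite /= /serM big_ord_recr /= subnn mulr0 addr0.
rewrite big_ord_recr /= IHk subSnn mul1r big1 ?add0r // => i _.
by rewrite ser_invfall_lt ?mul0r.
Qed.

End SeriesTheory.

Section FallTheory.
Variables (K : comNzRingType) (R : lalgType K) (b : int -> K).
Implicit Types (c f : nat -> R).

Lemma fall_serE c m :
  fall_ser b c m = \sum_(k < m) ser_invfall b k m *: c k + c m.
Proof. by rewrite /fall_ser big_ord_recr /= ser_invfall_diag scale1r. Qed.

Lemma fall_coefP f : fall_ser b (fall_coef b f) =1 f.
Proof.
apply: (epsilon_spec _ (fun c => fall_ser b c =1 f)).
have [|c cE] := @course_of_values R 0 (fun m c =>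
    f m - \sum_(k < m) ser_invfall b k m *: c k).
  by move=> n c c' cc'; congr (_ - _); apply: eq_bigr => i _; rewrite cc'.
by exists c => m; rewrite fall_serE [X in _ + X]cE addrC subrK.
Qed.

Lemma fall_ser_inj c c' : fall_ser b c =1 fall_ser b c' -> c =1 c'.
Proof.
move=> cc' m; have [n] := ubnP m; elim: n m => // n IHn m lt_mn.
have := cc' m; rewrite !fall_serE (eq_bigr (fun i : 'I_m =>
  ser_invfall b i m *: c' i)) => [/addrI //|i _].
by rewrite IHn // (leq_trans (ltn_ord i)).
Qed.

End FallTheory.

Section LambdaTheory.
Variables (K : fieldType) (a : int -> K).

Lemma LambdaP : is_Lambda a (Lambda a).
Proof.
apply: epsilon_spec.
have s0 : fall_ser a (S_ K) 0 = 1 by rewrite fall_serE big_ord0 add0r.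
have [g [sg gs]] := ser_inv s0.
have E : serN (fall_ser (hat a) (fall_coef (hat a) (serN g))) =1 g.
  by move=> m; rewrite -[RHS]serNK /serN fall_coefP.
exists (fall_coef (hat a) (serN g)); split.
- have := fall_coefP (hat a) (serN g) 0.
  rewrite fall_serE big_ord0 add0r => ->; rewrite /serN mul1r.
  by have := sg 0%N; rewrite /serM big_ord1 s0 mul1r.
- by move=> m; rewrite (eq_serM E (frefl _)).
- by move=> m; rewrite (eq_serM (frefl _) E).
Qed.

Lemma Lambda_unique L : is_Lambda a L -> L =1 Lambda a.
Proof.
move=> [_ Ls _]; have [_ _ sL] := LambdaP.
have LL := ser_invU Ls sL.
apply: (@fall_ser_inj _ _ (hat a)) => m.
by rewrite -(serNK (fall_ser _ L)) {1}/serN LL -/(serN _ m) serNK.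
Qed.

End LambdaTheory.

(* Main.v *)
Require Import Defs.
From HB Require Import structures.
From mathcomp Require Import all_boot all_order all_algebra.
From mathcomp Require Import monalg.
From mathcomp Require Import zify.
Import GRing.Theory.
Local Open Scope ring_scope.
Set Implicit Arguments.
Unset Strict Implicit.
Unset Printing Implicit Defensive.

(** Write sigma = \sum_k S_k / (t \downarrow a)^k and let lambda be the series
of the Lambda_k, so that lambda(-t) sigma(t) = 1. Three facts about the
coefficients c_k = [fall_coef b f k] of a series
f = \sum_k c_k / ((t - b_1) ... (t - b_k)) give the theorem.

Residues: for k >= 1, c_k is the coefficient of 1/t in
(t - b_1) ... (t - b_(k-1)) f. It depends only on the multiset
{b_1, ..., b_(k-1)}, and not on b_k ([fall_coef_residue]); in particular two
sequences that list these k-1 nodes in opposite orders have the same k-th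
coefficient ([fall_coef_rev]).

Products: if f is expanded along b with coefficients x_j, then in front of the
j-th term the other factor g may be expanded along the nodes b_(j+1), b_(j+2),
..., which completes each denominator to (t - b_1) ... (t - b_q). So the
coefficients of f g are \sum_j x_j u_(j, q-j), where the u_(j, -) are the
coefficients of g along the sequence b shifted by j ([fall_coefM], and
[fall_coefM_rev] for g f). This is the Leibniz rule of divided differences.

Quasideterminants: |A|_pq is the q-th entry of x A for every row vector x with
x_p = 1 such that all the other entries of x A vanish ([quasidet_row]), and
symmetrically for columns ([quasidet_col]).

For the first formula take f = lambda(-t), g = sigma and the nodes
b_i = a_(i+1-n), for the n x n matrix A. The shifts [n-p] in A are exactly those
for which row p holds the u_(p-1, -), so the product rule for f g = 1 says that
the coefficients x_0 = 1, x_1, ..., x_(n-1) of f satisfy the vanishing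
condition, and that |A|_1n = - x_n, the only term of the q = n relation which the matrix
omits. The nodes of x_n are a_(2-n), ..., a_0, while up to the sign (-1)^n the
element Lambda_n is the coefficient of lambda(-t) with the nodes
a_0, a_(-1), ..., a_(2-n): the same ones in the opposite order.

For the second formula lambda(t) sigma(-t) = 1 is used in the same way on
columns, with sigma expanded along a_n, a_(n-1), ... instead of a_1, a_2, ...;
the two expansions share their n-th coefficient because both have the nodes
a_1, ..., a_(n-1). *)

(** * The free algebra as an algebra over a commutative ring *)

Section MalgAlgebra.
Variables (K : comNzRingType) (M : monomType).

Lemma malg_scaleAr (c : K) (f g : {malg K[M]}) : c *: (f * g) = f * (c *: g).
Proof.
suff comm_c : c%:MP * f = f * c%:MP by rewrite -!mul_malgC !mulrA comm_c.
rewrite !malgM_def fgmulUg fgmulgU; apply: eq_bigr => k _.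
by rewrite mul1m mulm1 mulrC.
Qed.

(** Packed by hand rather than declared canonical: the head symbol of monoid
algebras already carries an instance, restricted to commutative monomials. *)
Definition malg_algType : algType K := HB.pack (malg M K)
  (GRing.Lalgebra_isAlgebra.Build K (malg M K) malg_scaleAr).

End MalgAlgebra.

(** * Divided differences of series *)

Lemma serM_serN (R : nzRingType) (f g : nat -> R) :
  serM f (serN g) =1 serN (serM (serN f) g).
Proof.
move=> m; rewrite /serN /serM mulr_sumr; apply: eq_bigr => i _.
rewrite !mulrA -exprD commr_sign -signr_odd -[in RHS]signr_odd oddD oddB //.
exact: leq_ord.
Qed.

Section DividedDifference.
Variables (K : comNzRingType) (R : lalgType K).
Implicit Types (f : nat -> R) (x : K).

(** The series (t - x) (f - f_0): subtracting f_0 first removes the term in t,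
and the term in x from the coefficient m = 0. If f has the
coefficients c_0, c_1, ... along b, then [ser_dd (b 1) f] has the coefficients
c_1, c_2, ... along the remaining nodes. *)
Definition ser_dd x f : nat -> R :=
  fun m => f m.+1 - (x *+ (0 < m)%N) *: f m.

Lemma eq_ser_dd x y f g : x = y -> f =1 g -> ser_dd x f =1 ser_dd y g.
Proof. by move=> -> fg m; rewrite /ser_dd !fg. Qed.

End DividedDifference.

Section Leibniz.
Variables (K : comNzRingType) (R : algType K).
Implicit Types (f g : nat -> R) (x : K).

(** Twisted Leibniz rule, from
f g - f_0 g_0 = (f - f_0) g + f_0 (g - g_0). *)
Lemma ser_ddMl x f g m :
  ser_dd x (serM f g) m = serM (ser_dd x f) g m + f 0%N * ser_dd x g m.
Proof.
pose e i := x *+ (0 < i)%N.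
have shift : e m *: serM f g m =
    \sum_(i < m.+1) e i *: f i * g (m - i)%N + e m *: (f 0%N * g m).
  case: m => [|m]; first by rewrite big_ord1 !scale0r mul0r addr0.
  rewrite /serM big_ord_recl [in RHS]big_ord_recl scale0r mul0r add0r subn0.
  rewrite scalerDr addrC scaler_sumr; congr (_ + _).
  by apply: eq_bigr => i _; rewrite scalerAl.
rewrite {1}/ser_dd -/(e m) shift /serM big_ord_recl subn0 /ser_dd.
under [in RHS]eq_bigr do rewrite mulrBl.
by rewrite sumrB mulrBr -scalerAr opprD [X in X + _]addrC addrACA.
Qed.

(** The other splitting, f g - f_0 g_0 = f (g - g_0) + (f - f_0) g_0. *)
Lemma ser_ddMr x f g m :
  ser_dd x (serM f g) m = serM f (ser_dd x g) m + ser_dd x f m * g 0%N.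
Proof.
pose e i := x *+ (0 < i)%N.
have shift : e m *: serM f g m =
    \sum_(i < m.+1) f i * (e (m - i)%N *: g (m - i)%N) + e m *: f m * g 0%N.
  case: m => [|m]; first by rewrite big_ord1 !scale0r mul0r mulr0 addr0.
  rewrite /serM big_ord_recr [in RHS]big_ord_recr /= subnn scale0r mulr0 addr0.
  rewrite scalerDr scalerAl scaler_sumr; congr (_ + _).
  by apply: eq_bigr => i _; rewrite /e subn_gt0 ltn_ord scalerAr.
rewrite {1}/ser_dd -/(e m) shift /serM big_ord_recr subnn /ser_dd.
under [in RHS]eq_bigr => i _ do rewrite mulrBr -subSn ?leq_ord //.
by rewrite sumrB mulrBl opprD addrACA.
Qed.

End Leibniz.

(** * Coefficients along inverse falling powers *)

Section FallCoef.
Variables (K : comNzRingType) (R : lalgType K).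
Implicit Types (b : int -> K) (f c : nat -> R).

(** Multiplying by t - b_1 cancels the first factor of the denominator, whereas
the definition by recursion exhibits the last one. *)
Lemma ser_dd_invfall b k :
  ser_dd (b 1) (ser_invfall b k.+1 : nat -> K^o) =1 ser_invfall (tau 1 b) k.
Proof.
elim: k => [|k IHk] m.
  rewrite -[RHS](proj2 (ser_invlinP (b 1))) /ser_dd /=.
  rewrite !ser1M; case: m => [|m] //=.
  by rewrite scale0r mulr0.
pose g : nat -> K^o := ser_invlin (b k.+2%:Z).
rewrite -[ser_invfall b _]/(serM (ser_invfall b k.+1 : nat -> K^o) g) ser_ddMl.
(* The constant term in the Leibniz rule is that of 1/(t \downarrow b)^(k+1). *)
rewrite [X in _ + X * _]ser_invfall_lt // mul0r addr0.
rewrite (eq_serM IHk (frefl _)) /= /tau.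
by rewrite -PoszD addn1.
Qed.

Lemma ser_dd_fall b c :
  ser_dd (b 1) (fall_ser b c) =1 fall_ser (tau 1 b) (fun k => c k.+1).
Proof.
move=> m; rewrite /ser_dd /fall_ser.
have -> : \sum_(k < m.+1) ser_invfall b k m *: c k =
          \sum_(k < m.+2) ser_invfall b k m *: c k.
  by rewrite [RHS]big_ord_recr ser_invfall_lt // scale0r /= addr0.
rewrite scaler_sumr -sumrB big_ord_recl.
rewrite [X in X + _](_ : _ = 0) ?add0r.
  apply: eq_bigr => k _; rewrite lift0 scalerA -scalerBl; congr (_ *: _).
  exact: ser_dd_invfall.
by case: m => [|m] /=; rewrite /ser1 ?mulr0n !scale0r ?scaler0 subrr.
Qed.

Lemma fall_coef_uniq b c f : fall_ser b c =1 f -> fall_coef b f =1 c.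
Proof.
move=> bc; apply: (@fall_ser_inj _ _ b) => m.
by rewrite fall_coefP bc.
Qed.

Lemma eq_fall_coef b b' f f' :
  b =1 b' -> f =1 f' -> fall_coef b f =1 fall_coef b' f'.
Proof.
move=> bb' ff'; have inv_bb' k : ser_invfall b k =1 ser_invfall b' k.
  by elim: k => //= k IHk; apply: eq_serM => // m; rewrite bb'.
apply: fall_coef_uniq => m; rewrite ff' -(fall_coefP b' f').
by apply: eq_bigr => k _; rewrite inv_bb'.
Qed.

Lemma fall_coef0 b f : fall_coef b f 0 = f 0%N.
Proof. by rewrite -[RHS](fall_coefP b) fall_serE big_ord0 add0r. Qed.

(** Taking out the first node, not the last, is what lets an induction produce
the shifted sequences of [fall_coefM]. *)
Lemma fall_coefS b f k :
  fall_coef b f k.+1 = fall_coef (tau 1 b) (ser_dd (b 1) f) k.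
Proof.
apply/esym; apply: (fall_coef_uniq (c := fun k => fall_coef b f k.+1)) => m.
by rewrite -ser_dd_fall; apply: eq_ser_dd => // i; rewrite fall_coefP.
Qed.

Lemma fall_coefD b f g k :
  fall_coef b (fun m => f m + g m) k = fall_coef b f k + fall_coef b g k.
Proof.
elim: k b f g => [|k IHk] b f g; rewrite ?fall_coef0 // !fall_coefS -IHk.
apply: eq_fall_coef => // m; rewrite /ser_dd scalerDr opprD.
by rewrite addrACA.
Qed.

Lemma fall_coefMr b f r k :
  fall_coef b (fun m => f m * r) k = fall_coef b f k * r.
Proof.
elim: k b f => [|k IHk] b f; rewrite ?fall_coef0 // !fall_coefS -IHk.
by apply: eq_fall_coef => // m; rewrite /ser_dd mulrBl scalerAl.
Qed.

(** The right-hand side is the residue, the coefficient of 1/t, of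
(t - b_1) ... (t - b_k) f. It shows that the coefficient is symmetric in the
nodes b_1, ..., b_k and does not involve b_(k+1). *)
Lemma fall_coef_residue b f k :
  fall_coef b f k.+1 =
  \sum_(j < k.+1) (\prod_(i < k) ('X - (b i.+1%:Z)%:P))`_j *: f j.+1.
Proof.
elim: k b f => [|k IHk] b f.
  rewrite fall_coefS fall_coef0 big_ord1 big_ord0 coef1 scale1r.
  by rewrite /ser_dd scale0r subr0.
pose P := \prod_(i < k) ('X - (tau 1 b i.+1%:Z)%:P).
have -> : \prod_(i < k.+1) ('X - (b i.+1%:Z)%:P) = ('X - (b 1)%:P) * P.
  rewrite big_ord_recl; congr (_ * _); apply: eq_bigr => i _.
  by rewrite lift0 /tau -PoszD addn1.
rewrite fall_coefS IHk -/P.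
have Pk : P`_k.+1 = 0.
  apply: nth_default.
  by rewrite /P size_prod_XsubC -[index_enum _]enumT size_enum_ord.
under [in RHS]eq_bigr => j _ do rewrite mulrBl coefB coefXM coefCM scalerBl.
rewrite sumrB [in RHS]big_ord_recl scale0r add0r.
rewrite [in X in _ - X]big_ord_recr /= Pk.
rewrite mulr0 scale0r addr0 -sumrB; apply: eq_bigr => j _.
by rewrite /ser_dd scalerBr scalerA mulrC.
Qed.

Lemma fall_coef_rev b b1 f n :
  (forall i, (i < n)%N -> b i.+1%:Z = b1 (n - i)%N%:Z) ->
  fall_coef b f n.+1 = fall_coef b1 f n.+1.
Proof.
move=> bb1; rewrite !fall_coef_residue.
suff -> : \prod_(i < n) ('X - (b i.+1%:Z)%:P) =
          \prod_(i < n) ('X - (b1 i.+1%:Z)%:P) by [].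
rewrite (reindex_inj rev_ord_inj); apply: eq_bigr => i _ /=.
by rewrite bb1 ?rev_ord_proof // subKn.
Qed.

End FallCoef.

(** * Expansion of a product *)

Section FallCoefAlg.
Variables (K : comNzRingType) (R : algType K).
Implicit Types (b : int -> K) (f g : nat -> R).

(** Substituting - t turns t - b_i into - (t - (- b_i)). *)
Lemma fall_coef_serN b f k :
  fall_coef (fun i => - b i) (serN f) k = (-1) ^+ k * fall_coef b f k.
Proof.
elim: k b f => [|k IHk] b f; first by rewrite !fall_coef0.
rewrite !fall_coefS exprSr -mulrA mulN1r -[- fall_coef _ _ _]mulrN1.
rewrite -fall_coefMr -IHk.
apply: eq_fall_coef => // m.
rewrite /ser_dd /serN exprS mulrN1 opprB mulrBr mulNrn scaleNr opprK.
by rewrite mulN1r mulNr addrC scalerAr.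
Qed.

Lemma fall_coefMl b f r k :
  fall_coef b (fun m => r * f m) k = r * fall_coef b f k.
Proof.
elim: k b f => [|k IHk] b f; rewrite ?fall_coef0 // !fall_coefS -IHk.
by apply: eq_fall_coef => // m; rewrite /ser_dd mulrBr scalerAr.
Qed.

(** 1/((t - b_1) ... (t - b_j)) times the m-th inverse falling power along the
nodes b_(j+1), b_(j+2), ... is the (j+m)-th one along b. This explains the
shift by j in the second factor; the proof iterates [ser_ddMl]. *)
Lemma fall_coefM b f g q :
  fall_coef b (serM f g) q =
  \sum_(j < q.+1) fall_coef b f j * fall_coef (tau j%:Z b) g (q - j)%N.
Proof.
elim: q b f => [|q IHq] b f.
  by rewrite big_ord1 !fall_coef0 /serM big_ord1.
rewrite big_ord_recl subn0 fall_coef0 fall_coefS.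
rewrite (eq_fall_coef (frefl _) (ser_ddMl _ _ _)) fall_coefD IHq addrC.
rewrite fall_coefMl -fall_coefS; congr (_ + _).
  by congr (_ * _); apply: eq_fall_coef => // i; rewrite /tau addr0.
apply: eq_bigr => j _; rewrite fall_coefS; congr (_ * _).
by apply: eq_fall_coef => // i; rewrite /tau lift0 -addrA -PoszD addn1.
Qed.

(** Not an instance of [fall_coefM]: the factor expanded along b stands on the
right, and the coefficients do not commute. *)
Lemma fall_coefM_rev b f g q :
  fall_coef b (serM g f) q =
  \sum_(j < q.+1) fall_coef (tau j%:Z b) g (q - j)%N * fall_coef b f j.
Proof.
elim: q b f => [|q IHq] b f.
  by rewrite big_ord1 !fall_coef0 /serM big_ord1.
rewrite big_ord_recl subn0 fall_coef0 fall_coefS.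
rewrite (eq_fall_coef (frefl _) (ser_ddMr _ _ _)) fall_coefD IHq addrC.
rewrite fall_coefMr -fall_coefS; congr (_ + _).
  by congr (_ * _); apply: eq_fall_coef => // i; rewrite /tau addr0.
apply: eq_bigr => j _; rewrite fall_coefS; congr (_ * _).
by apply: eq_fall_coef => // i; rewrite /tau lift0 -addrA -PoszD addn1.
Qed.

End FallCoefAlg.

(** * Quasideterminants from linear relations *)

Section Quasideterminants.
Variable R : nzRingType.

(** With r, c and M = A^pq as in the definition of |A|_pq, the relations say
that x' M = - r for the row x' of the remaining entries of x, hence
- r M^-1 c = x' c. *)
Lemma quasidet_row n (A : 'M[R]_n.+1) p q (x : 'rV[R]_n.+1) (V : 'M[R]_n) :
  is_mxinv (row' p (col' q A)) V -> x 0 p = 1 ->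
  (forall j, q != j -> (x *m A) 0 j = 0) -> quasidet A p q = (x *m A) 0 q.
Proof.
move=> /mxinvP[MV _] xp xA; rewrite /quasidet.
have mulE j : (x *m A) 0 j = A p j + (col' p x *m row' p A) 0 j.
  rewrite !mxE (bigD1_ord p) //= xp mul1r; congr (_ + _).
  by apply: eq_bigr => i _; rewrite !mxE.
have -> : row p (col' q A) = - (col' p x *m row' p (col' q A)).
  apply/rowP => j; rewrite 2!mxE [RHS]mxE; apply/eqP.
  rewrite -addr_eq0 -(xA _ (neq_lift q j)) mulE; apply/eqP; congr (_ + _).
  by rewrite !mxE; apply: eq_bigr => i _; rewrite !mxE.
rewrite !mulNmx -(mulmxA _ _ (mxinv _)) MV mulmx1 mulE [in LHS]mxE opprK.
by congr (_ + _); rewrite !mxE; apply: eq_bigr => i _; rewrite !mxE.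
Qed.

(** Here M z' = - c for the remaining entries z' of z, hence
- r M^-1 c = r z'. *)
Lemma quasidet_col n (A : 'M[R]_n.+1) p q (z : 'cV[R]_n.+1) (V : 'M[R]_n) :
  is_mxinv (row' p (col' q A)) V -> z q 0 = 1 ->
  (forall i, p != i -> (A *m z) i 0 = 0) -> quasidet A p q = (A *m z) p 0.
Proof.
move=> /mxinvP[_ VM] zq Az; rewrite /quasidet.
have mulE i : (A *m z) i 0 = A i q + (col' q A *m row' q z) i 0.
  rewrite !mxE (bigD1_ord q) //= zq mulr1; congr (_ + _).
  by apply: eq_bigr => j _; rewrite !mxE.
have -> : col q (row' p A) = - (row' p (col' q A) *m row' q z).
  apply/colP => i; rewrite 2!mxE [RHS]mxE; apply/eqP.
  rewrite -addr_eq0 -(Az _ (neq_lift p i)) mulE; apply/eqP; congr (_ + _).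
  by rewrite !mxE; apply: eq_bigr => j _; rewrite !mxE.
rewrite mulmxN -mulmxA (mulmxA (mxinv _)) VM mul1mx mulE [in LHS]mxE opprK.
by congr (_ + _); rewrite !mxE; apply: eq_bigr => j _; rewrite !mxE.
Qed.

(** Absorbs the 1s below the diagonal as terms of degree 0. *)
Lemma hess_entry n (F : nat -> nat -> R) (i j : 'I_n) (u : nat -> R) :
  u 0%N = 1 -> ((i <= j)%N -> F i.+1 j.+1 = u (j.+1 - i)%N) ->
  hess n F i j = if (i <= j.+1)%N then u (j.+1 - i)%N else 0.
Proof.
move=> u0 Fu; rewrite mxE /=; have [leij|ltji] := leqP i j.
  by rewrite ltnS leij Fu // leqW.
rewrite [in RHS]leq_eqVlt !ltnS [(i <= j)%N]leqNgt ltji orbF eqSS /=.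
by case: eqP => // ->; rewrite subnn.
Qed.

End Quasideterminants.

(** * Inverse series and Hessenberg quasideterminants *)

Section Hessenberg.
Variables (K : comNzRingType) (R : algType K).
Implicit Types (b : int -> K) (f g : nat -> R) (F : nat -> nat -> R).

Lemma fall_coef_ser1 b q : fall_coef b (ser1 : nat -> R) q.+1 = 0.
Proof. by rewrite fall_coef_residue big1 // => j _; rewrite scaler0. Qed.

Lemma sum_ord_if n q (E : nat -> R) : (q <= n)%N ->
  \sum_(j < n.+1) (if (j <= q)%N then E j else 0) = \sum_(j < q.+1) E j.
Proof. by move=> leqn; rewrite -big_mkcond (big_ord_widen n.+1). Qed.

(** The coefficients x_j of f along b are a row vector as in [quasidet_row]: by
[fall_coefM] the entries of x *m hess are the coefficients of f g = 1 along b.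
The last entry lacks just the term x_(n+1) of such a coefficient, whence
the value. *)
Lemma quasidet_hess_row n F b f g :
    serM f g =1 ser1 -> f 0%N = 1 -> g 0%N = 1 ->
    (forall i j : nat, (i <= j <= n)%N ->
       F i.+1 j.+1 = fall_coef (tau i%:Z b) g (j.+1 - i)%N) ->
  quasidet (hess n.+1 F) ord0 ord_max = - fall_coef b f n.+1.
Proof.
move=> fg f0 g0 FE.
pose E q j := fall_coef b f j * fall_coef (tau j%:Z b) g (q - j)%N.
pose x : 'rV_n.+1 := \row_j fall_coef b f j.
have sumE q : \sum_(j < q.+2) E q.+1 j = 0.
  rewrite -[RHS](fall_coef_ser1 b q) -(eq_fall_coef (frefl b) fg).
  by rewrite fall_coefM.
have xA j : (x *m hess n.+1 F) 0 j =
    \sum_(i < n.+1) if (i <= j.+1)%N then E j.+1 i else 0.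
  rewrite mxE; apply: eq_bigr => i _; rewrite mxE.
  rewrite (hess_entry (u := fall_coef (tau i%:Z b) g)) ?fall_coef0 //.
    by case: ifP => //; rewrite mulr0.
  by move=> leij; rewrite FE ?leij ?leq_ord.
rewrite (quasidet_row (hess_minor_inv n F) (x := x)).
- rewrite xA; apply/eqP; rewrite -addr_eq0; apply/eqP.
  rewrite -[RHS](sumE n) [in RHS]big_ord_recr /=.
  rewrite /E subnn fall_coef0 g0 mulr1; congr (_ + _).
  by apply: eq_bigr => i _; rewrite leqW ?leq_ord.
- by rewrite mxE fall_coef0.
- move=> j ne_jn; rewrite xA sum_ord_if // ltn_neqAle leq_ord andbT.
  by rewrite eq_sym -(inj_eq val_inj) in ne_jn.
Qed.

(** As [quasidet_hess_row], with the coefficients of g in decreasing order as a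
column; now it is the first entry that lacks a term. *)
Lemma quasidet_hess_col n F b f g :
    serM f g =1 ser1 -> f 0%N = 1 -> g 0%N = 1 ->
    (forall i j : nat, (i <= j <= n)%N ->
       F i.+1 j.+1 = fall_coef (tau (n - j)%N%:Z b) f (j.+1 - i)%N) ->
  quasidet (hess n.+1 F) ord0 ord_max = - fall_coef b g n.+1.
Proof.
move=> fg f0 g0 FE.
pose E q j := fall_coef (tau j%:Z b) f (q - j)%N * fall_coef b g j.
pose z : 'cV_n.+1 := \col_j fall_coef b g (n - j)%N.
have sumE q : \sum_(j < q.+2) E q.+1 j = 0.
  rewrite -[RHS](fall_coef_ser1 b q) -(eq_fall_coef (frefl b) fg).
  by rewrite fall_coefM_rev.
have Az i : (hess n.+1 F *m z) i 0 =
    \sum_(j < n.+1) if (j <= n.+1 - i)%N then E (n.+1 - i)%N j else 0.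
  rewrite mxE (reindex_inj rev_ord_inj); apply: eq_bigr => j _.
  rewrite [z _ _]mxE.
  have lejn := leq_ord j; have lein := leq_ord i.
  rewrite (hess_entry (u := fall_coef (tau j%:Z b) f)) ?fall_coef0 //=.
    rewrite subSS subKn // leq_subRL; last exact: leqW.
    rewrite -subSn // leq_subRL; last exact: leqW.
    rewrite addnC; case: ifP => _; last by rewrite mul0r.
    by rewrite /E subnAC.
  by move=> leij; rewrite FE ?leij ?subSS ?leq_subr // subKn.
rewrite (quasidet_col (hess_minor_inv n F) (z := z)).
- rewrite Az; apply/eqP; rewrite -addr_eq0; apply/eqP.
  rewrite -[RHS](sumE n) [in RHS]big_ord_recr /=.
  rewrite /E subnn fall_coef0 f0 mul1r; congr (_ + _).
  by apply: eq_bigr => i _; rewrite subn0 leqW ?leq_ord.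
- by rewrite mxE subnn fall_coef0.
- move=> [[|i] //= lein] _; rewrite Az sum_ord_if subSS ?leq_subr //.
  by rewrite -[(n - i)%N]prednK ?subn_gt0 // sumE.
Qed.

End Hessenberg.

(** * Dual sequences in an algebra *)

(** The theorem for any algebra R and any sequences S, L with
lambda(-t) sigma(t) = 1. *)
Section DualSeries.
Variables (K : comNzRingType) (R : algType K) (a : int -> K) (S L : nat -> R).
Hypotheses (S0 : S 0%N = 1) (L0 : L 0%N = 1).
Let s := fall_ser a S.
Let l := fall_ser (hat a) L.
Hypothesis ls : serM (serN l) s =1 ser1.

Let s0 : s 0%N = 1. Proof. by rewrite /s fall_serE big_ord0 add0r. Qed.

Let l0 : l 0%N = 1. Proof. by rewrite /l fall_serE big_ord0 add0r. Qed.

Let serN0 (f : nat -> R) : serN f 0%N = f 0%N.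
Proof. by rewrite /serN mul1r. Qed.

Let unsign n (x : R) : (-1) ^+ n * - ((-1) ^+ n.+1 * x) = x.
Proof. by rewrite exprS mulN1r mulNr opprK mulrA -expr2 sqrr_sign mul1r. Qed.

Let subSS1 i j : (i <= j)%N -> (j.+1 - i.+1 + 1 = j.+1 - i)%N.
Proof. by move=> leij; rewrite subSS addn1 subSn. Qed.

Lemma quasidet_row_shifts n (F := fun p q =>
    fall_coef (tau (- (n.+1%:Z - p%:Z)) a) s (q - p + 1)%N) :
  L n.+1 = (-1) ^+ n * quasidet (hess n.+1 F) ord0 ord_max.
Proof.
(* The nodes a_(1-n), a_(2-n), ... for which the rows of the matrix, whose size
   is n + 1, carry the right shifts. *)
pose b : int -> K := tau (- n%:Z) a.
rewrite (quasidet_hess_row (b := b) ls) ?serN0 //; last first.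
  move=> i j /andP[leij _]; rewrite /F subSS1 //.
  by apply: eq_fall_coef => // k; rewrite /b /tau; congr (a _); lia.
(* The value of the quasideterminant and L_(n+1) are both, up to sign,
   coefficients of lambda(-t) with the nodes a_(1-n), ..., a_0. *)
have bNN : b =1 fun i => - - b i by move=> i; rewrite opprK.
rewrite (eq_fall_coef bNN (frefl _)) fall_coef_serN unsign.
rewrite -(fall_coef_uniq (frefl l)).
by apply: fall_coef_rev => i ltin; rewrite /b /tau /hat; congr (- a _); lia.
Qed.

Lemma quasidet_col_shifts n (F := fun p q =>
    fall_coef (tau (1 - q%:Z) (hat a)) l (q - p + 1)%N) :
  S n.+1 = (-1) ^+ n * quasidet (hess n.+1 F) ord0 ord_max.
Proof.
have lsN : serM l (serN s) =1 ser1.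
  move=> m; rewrite serM_serN /serN ls.
  by case: m => [|m]; rewrite ?mul1r ?mulr0.
(* The nodes a_n, a_(n-1), ...; the first n of them are those of S_(n+1). *)
pose b : int -> K := fun i => a (n.+1%:Z - i).
rewrite (quasidet_hess_col (b := fun i => - b i) lsN) ?serN0 //; last first.
  move=> i j /andP[leij lejn]; rewrite /F subSS1 //.
  by apply: eq_fall_coef => // k; rewrite /b /tau /hat; congr (- a _); lia.
rewrite fall_coef_serN unsign -(fall_coef_uniq (frefl s)).
by apply: fall_coef_rev => i ltin; rewrite /b; congr (a _); lia.
Qed.

End DualSeries.

Theorem proposition18 (K : fieldType) (charK : [pchar K] =i pred0)
    (a : int -> K) (n : nat) :
  Lambda a n.+1 =
    (-1) ^+ n *
      quasidet (hess n.+1 (fun p q => S_shift a (n.+1%:Z - p%:Z) (q - p + 1)%N))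
        ord0 ord_max
  /\
  S_ K n.+1 =
    (-1) ^+ n *
      quasidet (hess n.+1 (fun p q => Lambda_shift a (1 - q%:Z) (q - p + 1)%N))
        ord0 ord_max.
Proof.
have [L0 ls _] := LambdaP a.
split.
- exact: (quasidet_row_shifts (R := malg_algType K {fmonom nat}) erefl L0 ls n).
- exact: (quasidet_col_shifts (R := malg_algType K {fmonom nat}) erefl L0 ls n).
Qed.
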